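(* Geodesic spheres in $G_{1/2}$ are always topological spheres: for every $p\in G_{1/2}$ and every $r>0$, the set of points at Riemannian distance exactly $r$ from $p$ is homeomorphic to $S^2$.
   Context: $G_{1/2}$ is the Lie group $\mathbb{R}^3$ with product $(x,y,z)\ast(x',y',z')=(x'e^{z}+x,\;y'e^{-z/2}+y,\;z'+z)$, equipped with the left-invariant Riemannian metric $ds^2=e^{-2z}dx^2+e^{z}dy^2+dz^2$. *)

(* Defs.v *)
From HB Require Import structures.
From mathcomp Require Import all_boot all_order all_algebra.
From mathcomp Require Import all_classical all_reals all_analysis.
From mathcomp Require Import ring.

Set Implicit Arguments.
Unset Strict Implicit.
Unset Printing Implicit Defensive.

Import Order.TTheory GRing.Theory Num.Theory.
Import numFieldNormedType.Exports.

Local Open Scope classical_set_scope.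
Local Open Scope ring_scope.

Definition homeomorphic (S T : topologicalType) : Prop :=
  exists (f : S -> T) (g : T -> S),
    [/\ cancel f g, cancel g f, continuous f & continuous g].

(* The norm of the normed module 'rV[R]_n is the sup norm, whence the explicit
   sum of squares. *)
Definition unit_sphere (R : realType) (n : nat) : set 'rV[R]_n.+1 :=
  [set v | \sum_(i < n.+1) v 0 i ^+ 2 = 1].
Arguments unit_sphere : clear implicits.

(* An alias of R^3: it keeps the topology and the calculus of 'rV[R]_3 as a
   global chart, and carries the non-commutative group law separately. *)
Definition G_half (R : realType) : Type := 'rV[R]_3.

HB.instance Definition _ (R : realType) :=
  NormedModule.copy (G_half R) 'rV[R]_3.

Section G_half_group.
Context {R : realType}.
Implicit Types p q v : G_half R.

Definition mkG (x y z : R) : G_half R := \row_(i < 3) [:: x; y; z]`_i.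

Definition xc p : R := (p : 'rV[R]_3) 0 0.
Definition yc p : R := (p : 'rV[R]_3) 0 1.
Definition zc p : R := (p : 'rV[R]_3) 0 2.

Definition G_half_one : G_half R := mkG 0 0 0.

Definition G_half_mul p q : G_half R :=
  mkG (xc q * expR (zc p) + xc p)
      (yc q * expR (- (zc p / 2)) + yc p)
      (zc q + zc p).

Definition G_half_inv p : G_half R :=
  mkG (- xc p * expR (- zc p)) (- yc p * expR (zc p / 2)) (- zc p).

Lemma xc_mkG x y z : xc (mkG x y z) = x. Proof. by rewrite /xc mxE. Qed.
Lemma yc_mkG x y z : yc (mkG x y z) = y. Proof. by rewrite /yc mxE. Qed.
Lemma zc_mkG x y z : zc (mkG x y z) = z. Proof. by rewrite /zc mxE. Qed.

Definition mkGE := (xc_mkG, yc_mkG, zc_mkG).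

Lemma G_halfP p q : xc p = xc q -> yc p = yc q -> zc p = zc q -> p = q.
Proof.
move=> ex ey ez; apply/rowP => -[[|[|[|//]]] i3].
- by rewrite (_ : Ordinal i3 = 0)//; exact/val_inj.
- by rewrite (_ : Ordinal i3 = 1)//; exact/val_inj.
- by rewrite (_ : Ordinal i3 = 2)//; exact/val_inj.
Qed.

Lemma G_half_mulA : associative G_half_mul.
Proof.
move=> p q s; apply: G_halfP; rewrite !mkGE ?mulrDl ?opprD ?expRD; ring.
Qed.

Lemma G_half_mul1 : left_id G_half_one G_half_mul.
Proof.
by move=> p; apply: G_halfP; rewrite !mkGE ?mul0r ?oppr0 ?expR0 ?mulr1 addr0.
Qed.

Lemma G_half_mulg1 : right_id G_half_one G_half_mul.
Proof. by move=> p; apply: G_halfP; rewrite !mkGE ?mul0r add0r. Qed.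

Lemma G_half_mulVg : left_inverse G_half_one G_half_inv G_half_mul.
Proof.
move=> p; apply: G_halfP; rewrite !mkGE.
- by rewrite mulNr subrr.
- by rewrite !mulNr opprK subrr.
- by rewrite subrr.
Qed.

Lemma G_half_mulgV : right_inverse G_half_one G_half_inv G_half_mul.
Proof.
move=> p; apply: G_halfP; rewrite !mkGE.
- by rewrite -mulrA -expRD addNr expR0 mulr1 addNr.
- by rewrite -mulrA -expRD subrr expR0 mulr1 addNr.
- by rewrite addNr.
Qed.

End G_half_group.

HB.instance Definition _ (R : realType) :=
  isGroup.Build (G_half R) (@G_half_mulA R) (@G_half_mul1 R) (@G_half_mulg1 R)
    (@G_half_mulVg R) (@G_half_mulgV R).

Section riemannian_metric.
Context {R : realType}.
Implicit Types (p q v : G_half R) (c : R -> G_half R).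

(* The value at the tangent vector v at p (read in the chart R^3) of
   ds^2 = e^(-2z) dx^2 + e^z dy^2 + dz^2. *)
Definition ds2 p v : R :=
  expR (- (2 * zc p)) * xc v ^+ 2 + expR (zc p) * yc v ^+ 2 + zc v ^+ 2.

Lemma derive_lmul p q v : 'D_v (fun s => (p * s)%g) q =
  mkG (xc v * expR (zc p)) (yc v * expR (- (zc p / 2))) (zc v).
Proof.
set w := mkG _ _ _.
rewrite /derive; apply: (@cvg_lim _ _) => //.
apply: (@cvg_trans _ (w @[h --> (0:R)^'])); last exact: cvg_cst.
apply: near_eq_cvg; near=> h.
have h0 : h != 0 by near: h; exact: nbhs_dnbhs_neq.
suff /= -> : (p * (h *: v + q)%R)%g = h *: w + (p * q)%g :> G_half R.
  by rewrite addrK scalerA mulVf// scale1r.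
have cE i (a b : G_half R) (k : R) :
  (k *: a + b : 'rV[R]_3) 0 i = k * (a : 'rV[R]_3) 0 i + (b : 'rV[R]_3) 0 i.
  by rewrite !mxE.
by apply: G_halfP; rewrite /xc /yc /zc !cE -!/(xc _) -!/(yc _) -!/(zc _) !mkGE;
  rewrite /xc /yc /zc !cE; ring.
Unshelve. all: by end_near. Qed.

Lemma ds2_left_invariant p q v :
  ds2 (p * q)%g ('D_v (fun s => (p * s)%g) q) = ds2 q v.
Proof.
rewrite derive_lmul /ds2 !mkGE !exprMn.
have e2 x : expR x ^+ 2 = expR (x + x) :> R by rewrite expRD expr2.
by rewrite !e2; congr (_ + _ + _); rewrite mulrCA -expRD mulrC;
  congr (expR _ * _); field.
Qed.

(* C^1 on the closed interval [a, b]: the derivative on ]a, b[ extends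
   continuously to [a, b]. *)
Definition C1_on (a b : R) c : Prop :=
  derivable_oo_LRcontinuous c a b /\
  exists2 c' : R -> G_half R,
    {within `[a, b], continuous c'} & {in `]a, b[, derive1 c =1 c'}.

Definition piecewise_C1 c : Prop :=
  exists2 s : seq R, itv_partition 0 1 s &
    forall i, (i < size s)%N ->
      C1_on (nth 1 (0 :: s) i) (nth 1 (0 :: s) i.+1) c.

(* derive1 c takes irrelevant values at the finitely many break points. *)
Definition curve_length c : R :=
  \int[lebesgue_measure]_(t in `[0, 1]) Num.sqrt (ds2 (c t) (derive1 c t)).

Definition G_half_dist p q : R :=
  inf [set curve_length c | c in
    [set c | [/\ piecewise_C1 c, c 0 = p & c 1 = q]]].

Definition geodesic_sphere p (r : R) : set (G_half R) :=
  [set q | G_half_dist p q = r].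

End riemannian_metric.

(* Main.v *)
(* Write p = (x0, y0, z0).  The distance from p to (x, y, z) is at least
   |z - z0|, with equality on the vertical axis through p.  For 0 <= s < 1, the
   scaling (x, y, z) |-> (x0 + s (x - x0), y0 + s (y - y0), z) fixes p, multiplies
   the horizontal speed of a curve by s and keeps its vertical speed; hence it
   strictly decreases the distance to p off that axis.  So every horizontal ray
   issued from the axis at a height |z - z0| < r meets the sphere of radius r
   exactly once, and the only points of the sphere with |z - z0| = r are its two
   poles.  Sliding along horizontal rays is therefore a continuous bijection from
   this compact set onto the round sphere. *)

Require Import Defs.
From mathcomp Require Import all_boot all_order all_algebra.
From mathcomp Require Import all_classical all_reals all_analysis.
From mathcomp Require Import measurable_realfun ring lra.

Set Implicit Arguments.
Unset Strict Implicit.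
Unset Printing Implicit Defensive.

Import Order.TTheory GRing.Theory Num.Theory.
Import numFieldNormedType.Exports.
Local Open Scope classical_set_scope.
Local Open Scope ring_scope.

(** * Integrals over intervals: concatenation and comparison off finite sets *)

Lemma integrableU_disj (d : measure_display) (T : measurableType d)
    (R : realType) (mu : {measure set T -> \bar R}) (A B : set T)
    (f : T -> \bar R) :
  measurable A -> measurable B -> [disjoint A & B] ->
  mu.-integrable A f -> mu.-integrable B f -> mu.-integrable (A `|` B) f.
Proof.
move=> mA mB AB /integrableP[mfA ifA] /integrableP[mfB ifB].
have mf : measurable_fun (A `|` B) f by apply/measurable_funU.
apply/integrableP; split=> //.
rewrite ge0_integral_setU//; last exact: measurableT_comp.
exact: lte_add_pinfty.
Qed.

Section piecewise.
Context {R : realType}.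
Notation mu := (@lebesgue_measure R).
Implicit Types (a b t : R) (s : seq R) (f g h : R -> R).

(** Lifts a property [P] of single C^1 pieces to a property [Q] of the whole interval, by induction
    on the partition. [Q] must also hold on degenerate intervals, because the empty partition forces
    [a = b]. *)
Lemma itv_partition_ind (P Q : R -> R -> Prop) a b s :
  (forall a, Q a a) -> (forall a b, a < b -> P a b -> Q a b) ->
  (forall a b c, a <= b -> b <= c -> Q a b -> Q b c -> Q a c) ->
  itv_partition a b s ->
  (forall i, (i < size s)%N -> P (nth b (a :: s) i) (nth b (a :: s) i.+1)) ->
  Q a b.
Proof.
move=> Q0 Q1 Qcat; elim: s a => [a /itv_partition_nil <- _ //|x s ih a abs H].
have ax : a < x by case: abs => /= /andP[].
have xbs := itv_partition_cons abs.
apply: (Qcat a x b (ltW ax) (itv_partition_le xbs)).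
  by apply: Q1 => //; exact: (H 0).
by apply: ih xbs _ => i si; exact: (H i.+1).
Qed.

Lemma integrable_itv_cat f a b t : a <= t -> t <= b ->
  mu.-integrable `[a, t] (EFin \o f) -> mu.-integrable `[t, b] (EFin \o f) ->
  mu.-integrable `[a, b] (EFin \o f).
Proof.
move=> at_ tb fat ftb.
rewrite (@itv_bndbnd_setU _ _ _ (BRight t)) ?bnd_simp//.
apply: integrableU_disj => //.
  apply/disj_setPLR => x /=; rewrite !in_itv/= => /andP[_ xt] /andP[tx _].
  by rewrite ltNge xt in tx.
by apply: integrableS ftb => //; exact: subset_itv_oc_cc.
Qed.

(** The points of [s] and the two end points form a null set. This matters because [derive1] of a
    piecewise C^1 curve is controlled only off such a set. *)
Lemma le_Rintegral_off_finite s f g a b :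
  mu.-integrable `[a, b] (EFin \o f) -> mu.-integrable `[a, b] (EFin \o g) ->
  (forall t, t \in `]a, b[ -> t \notin s -> f t <= g t) ->
  \int[mu]_(t in `[a, b]) f t <= \int[mu]_(t in `[a, b]) g t.
Proof.
move=> intf intg fg; pose N : set R := [set` a :: b :: s].
have cN : countable N by exact/finite_set_countable/finite_seq.
have mN : measurable N.
  by apply: countable_measurable => // t; exact: measurable_set1.
have N0 : mu N = 0%E by exact: countable_lebesgue_measure0.
have mD : measurable (`[a, b]%classic `\` N) by exact: measurableD.
have RintN h : mu.-integrable `[a, b] (EFin \o h) ->
    \int[mu]_(t in `[a, b]) h t = \int[mu]_(t in `[a, b] `\` N) h t.
  by move=> inth; congr fine; exact: negligible_integral.
rewrite (RintN f)// (RintN g)//; apply: le_Rintegral => //.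
- by apply: integrableS intf => //; exact: subDsetl.
- by apply: integrableS intg => //; exact: subDsetl.
- move=> t [] /=; rewrite in_itv/= => /andP[ta tb].
  move=> /negP; rewrite !inE !negb_or => /and3P[tNa tNb tNs].
  by apply: fg => //; rewrite in_itv/= !lt_neqAle ta tb eq_sym tNa tNb.
Qed.

Lemma eq_Rintegral_off_finite s f g a b :
  mu.-integrable `[a, b] (EFin \o f) -> mu.-integrable `[a, b] (EFin \o g) ->
  (forall t, t \in `]a, b[ -> t \notin s -> f t = g t) ->
  \int[mu]_(t in `[a, b]) f t = \int[mu]_(t in `[a, b]) g t.
Proof.
move=> intf intg fg; apply/eqP; rewrite eq_le; apply/andP; split.
  by apply: (@le_Rintegral_off_finite s) => // t tab ts; rewrite fg.
by apply: (@le_Rintegral_off_finite s) => // t tab ts; rewrite fg.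
Qed.

Lemma Rintegral_cst01 (k : R) : \int[mu]_(t in `[0, 1]) k = k.
Proof.
have mu01 : fine ((@lebesgue_measure R) `[0, 1]%classic) = 1.
  by rewrite lebesgue_measure_itv/= lte_fin ltr01 sube0.
by rewrite Rintegral_cst// -[RHS]mulr1; congr (_ * _); exact: mu01.
Qed.

End piecewise.

(** * C^1 curves: integrability and the fundamental theorem of calculus *)

Lemma within_continuous_comp (S T U : topologicalType) (A : set S) (f : S -> T)
    (g : T -> U) :
  {within A, continuous f} -> continuous g -> {within A, continuous (g \o f)}.
Proof.
move=> cf cg x; apply: (@continuous_comp (subspace A) T U f g).
  exact: cf.
exact: cg.
Qed.

Section C1_curves.
Context {R : realType}.
Notation mu := (@lebesgue_measure R).
Implicit Types (a b t : R) (f : R -> R).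

Lemma integrable_itv_oo_cc f a b :
  mu.-integrable `]a, b[ (EFin \o f) -> mu.-integrable `[a, b] (EFin \o f).
Proof.
move=> /integrableP[mf intf]; apply/integrableP; split.
  by apply/emeasurable_fun_itv_bndo_bndcP/emeasurable_fun_itv_obnd_cbndP.
by rewrite integral_itv_bndoo//; exact: measurableT_comp.
Qed.

Lemma derive1_coord (c : R -> G_half R) t (i : 'I_3) : derivable c t 1 ->
  derive1 (fun u => (c u : 'rV[R]_3) 0 i) t = (derive1 c t : 'rV[R]_3) 0 i.
Proof. by move=> dc; rewrite !derive1E (@derive_mx _ _ 1 3 c)// mxE. Qed.

(** On the open interval [derive1 c] agrees with [c'], and [F (c t, c' t)] is continuous on the
    compact interval. Below, [F] is either the speed or one coordinate of the velocity. *)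
Lemma C1_integrable a b (c : R -> G_half R) (F : G_half R * G_half R -> R) :
  C1_on a b c -> continuous F ->
  mu.-integrable `[a, b] (EFin \o (fun t => F (c t, derive1 c t))).
Proof.
move=> [dc [c' cc' c'E]] cF; apply: integrable_itv_oo_cc.
apply: (@eq_integrable _ _ _ mu _ _ (EFin \o (fun t => F (c t, c' t)))) => //.
  by move=> t; rewrite inE/= => tab; rewrite c'E.
apply: (@integrableS _ _ _ mu `[a, b]) => //; first exact: subset_itv_oo_cc.
have cc := derivable_oo_LRcontinuous_within dc.
have ccc' : {within `[a, b], continuous (fun t => (c t, c' t))}.
  by move=> t; exact: (cvg_pair (cc t) (cc' t)).
apply: continuous_compact_integrable; first exact: segment_compact.
exact: (within_continuous_comp ccc' cF).
Qed.

Lemma coord_continuous3 (i : 'I_3) :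
  continuous (fun v : G_half R => (v : 'rV[R]_3) 0 i).
Proof. exact: coord_continuous. Qed.

Lemma continuous_coord_snd (i : 'I_3) :
  continuous (fun u : G_half R * G_half R => (u.2 : 'rV[R]_3) 0 i).
Proof.
move=> u; apply: (@continuous_comp _ _ _ snd
  (fun v : G_half R => (v : 'rV[R]_3) 0 i)); first exact: cvg_snd.
exact: coord_continuous3.
Qed.

(** The upper bound is any [t] of the interval, and not only [b], because the height has to be
    controlled at every time of a curve. *)
Lemma C1_FTC a b t (c : R -> G_half R) (i : 'I_3) :
  C1_on a b c -> t \in `[a, b] ->
  \int[mu]_(u in `[a, t]) (derive1 c u : 'rV[R]_3) 0 i =
    (c t : 'rV[R]_3) 0 i - (c a : 'rV[R]_3) 0 i.
Proof.
move=> [[dc ca cb] [c' cc' c'E]]; rewrite in_itv/= => /andP[].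
rewrite le_eqVlt => /predU1P[<- _|at_ tb].
  by rewrite set_itv1 Rintegral_set1 subrr.
have subo u : u \in `]a, t[ -> u \in `]a, b[.
  by rewrite !in_itv/= => /andP[-> ut]; exact: lt_le_trans tb.
have subc : `[a, t] `<=` `[a, b] by apply: subset_itvl; rewrite bnd_simp.
pose X (v : G_half R) := (v : 'rV[R]_3) 0 i.
have cX : continuous X by exact: coord_continuous3.
pose f := X \o c; pose f' := X \o c'.
have cf' : {within `[a, t], continuous f'}.
  exact: (continuous_subspaceW subc (within_continuous_comp cc' cX)).
(* For [t = b] this is the one-sided limit contained in [C1_on]; for [t < b] it follows from
   differentiability at [t]. *)
have ct : c @ t^'- --> c t.
  move: tb; rewrite le_eqVlt => /predU1P[->//|tb].
  apply: cvg_at_left_filter; apply/differentiable_continuous.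
  by apply/derivable1_diffP; apply: dc; rewrite in_itv/= at_.
have df : derivable_oo_LRcontinuous f a t.
  split.
  - move=> u /subo uab.
    by have /(@derivable_mxP _ _ 1 3 c) := dc u uab; exact.
  - by apply: continuous_cvg ca; exact: cX.
  - by apply: continuous_cvg ct; exact: cX.
have f'E : {in `]a, t[, derive1 f =1 f'}.
  by move=> u /subo uab; rewrite derive1_coord ?c'E//; exact: dc.
rewrite -[RHS]/(fine ((f t)%:E - (f a)%:E)) -(continuous_FTC2 at_ cf' df f'E).
apply: (@eq_Rintegral_off_finite _ [::]).
- apply: (@integrableS _ _ _ mu `[a, b]) => //.
  apply: (@C1_integrable _ _ _ (X \o snd)); first by split=> //; exists c'.
  exact: continuous_coord_snd.
- by apply: continuous_compact_integrable => //; exact: segment_compact.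
- by move=> u /subo uab _; rewrite c'E.
Qed.

End C1_curves.

(** * From C^1 to piecewise C^1 curves *)

Lemma cvg_rV (R : realType) n (T : Type) (F : set_system T) {FF : Filter F}
    (f : T -> 'rV[R]_n) (l : 'rV[R]_n) :
  (forall i, f x 0 i @[x --> F] --> l 0 i) -> f @ F --> l.
Proof.
move=> fl; apply/cvgrPdist_le => /= e e0; near=> x.
rewrite [leLHS]/Num.Def.normr/= mx_normrE (bigmax_le _ (ltW e0))//= => -[i j] _.
rewrite ord1 !mxE/=; move: j; near: x; apply: filter_forall => /= j.
exact: ((cvgrPdist_le _ _).1 (fl j)).
Unshelve. all: by end_near. Qed.

Section piecewise_C1_curves.
Context {R : realType}.
Notation mu := (@lebesgue_measure R).
Implicit Types c : R -> G_half R.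

Lemma piecewise_C1_integrable c (F : G_half R * G_half R -> R) :
  piecewise_C1 c -> continuous F ->
  mu.-integrable `[0, 1] (EFin \o (fun t => F (c t, derive1 c t))).
Proof.
move=> [s s01 cs] cF; pose f t := F (c t, derive1 c t).
apply: (@itv_partition_ind _ (fun a b => C1_on a b c)
  (fun a b => mu.-integrable `[a, b] (EFin \o f)) 0 1 s) => //.
- move=> a; rewrite set_itv1; apply/integrableP.
  by split; [exact: measurable_fun_set1 | rewrite integral_set1].
- by move=> a b _ cab; exact: C1_integrable.
- by move=> a b t ab bt; exact: integrable_itv_cat.
Qed.

Lemma piecewise_C1_FTC c t (i : 'I_3) : piecewise_C1 c -> t \in `[0, 1] ->
  \int[mu]_(u in `[0, t]) (derive1 c u : 'rV[R]_3) 0 i =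
    (c t : 'rV[R]_3) 0 i - (c 0 : 'rV[R]_3) 0 i.
Proof.
move=> cc; have [s s01 cs] := cc; move: t.
pose f u := (derive1 c u : 'rV[R]_3) 0 i.
have intf : mu.-integrable `[0, 1] (EFin \o f).
  apply: (@piecewise_C1_integrable c (fun u => (u.2 : 'rV[R]_3) 0 i)) => //.
  exact: continuous_coord_snd.
apply: (@itv_partition_ind _ (fun a b => C1_on a b c)
  (fun a b => 0 <= a -> b <= 1 -> forall t, t \in `[a, b] ->
    \int[mu]_(u in `[a, t]) f u =
      (c t : 'rV[R]_3) 0 i - (c a : 'rV[R]_3) 0 i) 0 1 s) => //.
- move=> a _ _ t; rewrite in_itv/= -eq_le => /eqP <-.
  by rewrite set_itv1 Rintegral_set1 subrr.
- by move=> a b _ cab _ _ t; exact: C1_FTC.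
- move=> a b d ab bd Qab Qbd a0 d1 t; rewrite in_itv/= => /andP[at_ td].
  have [tb|bt] := leP t b.
    by apply: Qab => //; [exact: le_trans d1 | rewrite in_itv/= at_].
  have intat : mu.-integrable `[a, t] (EFin \o f).
    apply: integrableS intf => //; apply: subset_itv; rewrite bnd_simp//.
    exact: le_trans d1.
  (* Beyond [b] the integral splits at [b], and the formula is known on both sides. *)
  have := @Rintegral_itvB _ f (BLeft a) (BRight t) b intat.
  rewrite !bnd_simp ab (ltW bt) => /(_ isT isT).
  rewrite (Qab a0 (le_trans bd d1) b) ?in_itv/= ?ab ?lexx//.
  rewrite Rintegral_itv_obnd_cbnd; last first.
    apply: integrableS intat => //; apply: subset_itvr; rewrite bnd_simp//.
  rewrite (Qbd (le_trans a0 ab) d1)// ?in_itv/= ?(ltW bt)//.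
  by move=> /eqP; rewrite subr_eq => /eqP ->; ring.
Qed.

End piecewise_C1_curves.

(** * Coordinatewise affine deformations of curves *)

Section coordinatewise_affine.
Context {R : realType}.
Implicit Types (c : R -> G_half R) (al be ga : 'rV[R]_3).

(** Common form of the three constructions used below: segments ([c] constant), horizontal scalings
    ([be = 0]) and shears ([al] all ones, [ga = 0]), which add [t] times a fixed vector. *)
Definition affine_curve al be ga c : R -> G_half R := fun t =>
  \row_(i < 3) (al 0 i * (c t : 'rV[R]_3) 0 i + be 0 i * t + ga 0 i).

Lemma affine_curve_derive1 al be ga c t : derivable c t 1 ->
  derivable (affine_curve al be ga c) t 1 /\
  derive1 (affine_curve al be ga c) t =
    \row_(i < 3) (al 0 i * (derive1 c t : 'rV[R]_3) 0 i + be 0 i).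
Proof.
move=> dc.
have dci i : is_derive t 1
    (fun u => al 0 i * (c u : 'rV[R]_3) 0 i + be 0 i * u + ga 0 i)
    (al 0 i * (derive1 c t : 'rV[R]_3) 0 i + be 0 i).
  have dX : is_derive t 1 (fun u => (c u : 'rV[R]_3) 0 i)
      ((derive1 c t : 'rV[R]_3) 0 i).
    rewrite -derive1_coord// derive1E; apply: DeriveDef => //.
    by have /(@derivable_mxP _ _ 1 3 c) := dc; exact.
  by apply: is_derive_eq; rewrite addr0 /GRing.scale/= mulr1.
have daff : derivable (affine_curve al be ga c) t 1.
  apply/(@derivable_mxP _ _ 1 3) => j i; rewrite ord1.
  have [+ _] := dci i; congr (derivable _ t 1).
  by apply/funext => u; rewrite mxE.
split=> //; apply/rowP => i; rewrite mxE -derive1_coord//.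
rewrite derive1E -(@derive_val _ _ _ _ _ _ _ (dci i)); congr ('D_1 _ t).
by apply/funext => u; rewrite mxE.
Qed.

Lemma cvg_affine_curve al be ga c t (F : set_system R) {FF : Filter F} :
  F --> t -> c @ F --> c t ->
  affine_curve al be ga c @ F --> affine_curve al be ga c t.
Proof.
move=> Ft ct; apply: (@cvg_rV _ 3) => i.
rewrite mxE; under eq_fun do rewrite mxE.
apply: cvgD; last exact: cvg_cst.
apply: cvgD; apply: cvgM => //; try exact: cvg_cst.
exact: (cvg_comp _ _ ct (@coord_continuous3 R i _)).
Qed.

Lemma C1_affine_curve al be ga c a b :
  C1_on a b c -> C1_on a b (affine_curve al be ga c).
Proof.
move=> [[dc ca cb] [c' cc' c'E]]; split.
  split.
  - by move=> t /dc /(affine_curve_derive1 al be ga) [].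
  - by apply: cvg_affine_curve => //; exact: cvg_within.
  - by apply: cvg_affine_curve => //; exact: cvg_within.
exists (fun t => \row_(i < 3) (al 0 i * (c' t : 'rV[R]_3) 0 i + be 0 i)).
  apply: (@within_continuous_comp _ _ _ _ c' (fun v : G_half R =>
    \row_(i < 3) (al 0 i * (v : 'rV[R]_3) 0 i + be 0 i) : G_half R)) => //.
  move=> v; apply: (@cvg_rV R 3 (G_half R) (nbhs v) (nbhs_filter v)) => i.
  rewrite mxE; under eq_fun do rewrite mxE.
  apply: cvgD; last exact: cvg_cst.
  by apply: cvgM; [exact: cvg_cst | exact: coord_continuous3].
move=> t tab; have [_ ->] := affine_curve_derive1 al be ga (dc t tab).
by rewrite c'E.
Qed.

Lemma piecewise_C1_affine_curve al be ga c :
  piecewise_C1 c -> piecewise_C1 (affine_curve al be ga c).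
Proof.
by move=> [s s01 cs]; exists s => // i /cs; exact: C1_affine_curve.
Qed.

Lemma piecewise_C1_derivable c : piecewise_C1 c ->
  exists s : seq R, forall t, t \in `]0, 1[ -> t \notin s -> derivable c t 1.
Proof.
move=> [s s01 cs].
apply: (@itv_partition_ind _ (fun a b => C1_on a b c) (fun a b =>
  exists s : seq R, forall t, t \in `]a, b[ -> t \notin s -> derivable c t 1)
  0 1 s) => //.
- move=> a; exists [::] => t; rewrite in_itv/= => /andP[/lt_trans /[apply]].
  by rewrite ltxx.
- by move=> a b _ [[dc _ _] _]; exists [::] => t /dc.
- move=> a b d ab bd [s1 H1] [s2 H2]; exists (b :: s1 ++ s2) => t.
  rewrite !in_itv/= in_cons mem_cat !negb_or => /andP[at_ td] /and3P[tb ts1 ts2].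
  case: (ltgtP t b) tb => // tb _.
    by apply: H1 => //; rewrite in_itv/= at_.
  by apply: H2 => //; rewrite in_itv/= tb.
Qed.

Lemma piecewise_C1_cst (p : G_half R) : piecewise_C1 (cst p).
Proof.
exists [:: 1]; first exact: itv_partition1.
case=> //= _; split.
  by split; [move=> t _; exact: derivable_cst | exact: cvg_cst | exact: cvg_cst].
exists (cst 0); first by move=> t; exact: cvg_cst.
by move=> t _; rewrite derive1_cst.
Qed.

End coordinatewise_affine.

(** * Pointwise estimates of the speed *)

Section metric_estimates.
Context {R : realType}.
Implicit Types (p q v w : G_half R).

(** The three terms are the squares of the left-invariant coframe [e^(-z) dx], [e^(z/2) dy], [dz],
    so the speed is a Euclidean norm in that coframe. *)
Lemma ds2_sumsq p v : ds2 p v =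
  (expR (- zc p) * xc v) ^+ 2 + (expR (zc p / 2) * yc v) ^+ 2 + zc v ^+ 2.
Proof.
have e2 x : expR x ^+ 2 = expR (x + x) :> R by rewrite expRD expr2.
rewrite /ds2 !exprMn !e2; congr (expR _ * _ + expR _ * _ + _); by field.
Qed.

Lemma ds2_ge0 p v : 0 <= ds2 p v.
Proof. by rewrite ds2_sumsq !addr_ge0// sqr_ge0. Qed.

Lemma continuous_ds2 : continuous (fun u : G_half R * G_half R => ds2 u.1 u.2).
Proof.
have c1 i : continuous (fun u : G_half R * G_half R => (u.1 : 'rV[R]_3) 0 i).
  move=> u; apply: (@continuous_comp _ _ _ fst
    (fun v : G_half R => (v : 'rV[R]_3) 0 i)); first exact: cvg_fst.
  exact: coord_continuous3.
have c2 := @continuous_coord_snd R.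
have cexp (f : G_half R * G_half R -> R) : continuous f ->
    continuous (fun u => expR (f u)).
  by move=> cf u; apply: continuous_comp (cf u) _; exact: continuous_expR.
move=> u; apply: cvgD; last by apply: cvgM; exact: c2.
apply: cvgD; apply: cvgM; try by apply: cvgM; exact: c2.
  apply: (cexp (fun u => - (2 * zc u.1))) => {}u.
  by apply: cvgN; apply: cvgM; [exact: cvg_cst | exact: c1].
by apply: (cexp (fun u => zc u.1)); exact: c1.
Qed.

Lemma continuous_speed :
  continuous (fun u : G_half R * G_half R => Num.sqrt (ds2 u.1 u.2)).
Proof.
move=> u; apply: (@continuous_comp _ _ _ (fun u : G_half R * G_half R =>
  ds2 u.1 u.2) Num.sqrt); [exact: continuous_ds2 | exact: sqrt_continuous].
Qed.

Lemma normr_zc_le_speed p v : `|zc v| <= Num.sqrt (ds2 p v).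
Proof.
by rewrite -sqrtr_sqr ler_sqrt ?ds2_ge0// ds2_sumsq lerDr addr_ge0// sqr_ge0.
Qed.

(** For [|z| <= M] both [e^(-z)] and [e^(z/2)] are at least [e^(-M)]. The right-hand side is the
    horizontal part of the squared speed. *)
Lemma sqr_horizontal_le p v (i : 'I_3) (M : R) : i != 2 -> `|zc p| <= M ->
  (expR (- M) * (v : 'rV[R]_3) 0 i) ^+ 2 <= ds2 p v - zc v ^+ 2.
Proof.
move=> i2 zM; have M0 : 0 <= M by exact: le_trans zM.
have scale (a x : R) : - M <= a -> (expR (- M) * x) ^+ 2 <= (expR a * x) ^+ 2.
  move=> Ma; rewrite !exprMn ler_wpM2r ?sqr_ge0// ler_sqr ?nnegrE ?expR_ge0//.
  by rewrite ler_expR.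
rewrite ds2_sumsq addrK.
have /andP[zM1 zM2] : - M <= zc p <= M by rewrite -ler_norml.
case: i i2 => -[|[|[|//]]] i3 // _.
- rewrite (_ : Ordinal i3 = 0); last exact/val_inj.
  apply: le_trans (scale (- zc p) _ _) _; first by rewrite lerN2.
  by rewrite lerDl sqr_ge0.
- rewrite (_ : Ordinal i3 = 1); last exact/val_inj.
  apply: le_trans (scale (zc p / 2) _ _) _; first by lra.
  by rewrite lerDr sqr_ge0.
Qed.

Lemma normr_coord_le_speed p v (i : 'I_3) (M : R) : `|zc p| <= M ->
  `|(v : 'rV[R]_3) 0 i| <= expR M * Num.sqrt (ds2 p v).
Proof.
move=> zM; have M0 : 0 <= M by exact: le_trans zM.
have [->|i2] := eqVneq i 2.
  apply: le_trans (normr_zc_le_speed p v) _.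
  by rewrite ler_peMl ?sqrtr_ge0// -expR0 ler_expR.
rewrite mulrC -ler_pdivrMr ?expR_gt0// -expRN mulrC.
rewrite -[expR (- M)]ger0_norm ?expR_ge0// -normrM -sqrtr_sqr.
rewrite ler_sqrt ?ds2_ge0//; apply: le_trans (sqr_horizontal_le v i2 zM) _.
by rewrite gerBl sqr_ge0.
Qed.

(** Changing the height by at most [e] multiplies the coefficients [e^(-2z)] and [e^z] by at most
    [e^(2e)]; the square root halves the exponent. *)
Lemma speed_base_le p q v (e : R) : `|zc q - zc p| <= e ->
  Num.sqrt (ds2 q v) <= expR e * Num.sqrt (ds2 p v).
Proof.
move=> ze; have e0 : 0 <= e by exact: le_trans ze.
have /andP[ze1 ze2] : - e <= zc q - zc p <= e by rewrite -ler_norml.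
have -> : expR e = Num.sqrt (expR e ^+ 2).
  by rewrite sqrtr_sqr ger0_norm ?expR_ge0.
rewrite -sqrtrM ?sqr_ge0//.
rewrite ler_sqrt ?mulr_ge0 ?sqr_ge0 ?ds2_ge0// /ds2.
have -> : expR e ^+ 2 = expR (e + e) by rewrite expRD expr2.
have [X Y Z] : [/\ 0 <= xc v ^+ 2, 0 <= yc v ^+ 2 & 0 <= zc v ^+ 2].
  by rewrite !sqr_ge0.
move: (xc v ^+ 2) (yc v ^+ 2) (zc v ^+ 2) X Y Z => x y z X Y Z.
rewrite !mulrDr !mulrA -!expRD.
apply: lerD; first apply: lerD.
- by rewrite (ler_wpM2r X)// ler_expR; lra.
- by rewrite (ler_wpM2r Y)// ler_expR; lra.
- by rewrite ler_peMl// -expR0 ler_expR addr_ge0.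
Qed.

(** A crude triangle inequality: since [|ai| <= N], expanding the squares gives at most
    [N^2 + 6 N B + 3 B^2], which is below [(N + 3 B)^2]. *)
Lemma sqrt_sumsq_add_le (a1 a2 a3 b1 b2 b3 B : R) :
  `|b1| <= B -> `|b2| <= B -> `|b3| <= B ->
  Num.sqrt ((a1 + b1) ^+ 2 + (a2 + b2) ^+ 2 + (a3 + b3) ^+ 2) <=
    Num.sqrt (a1 ^+ 2 + a2 ^+ 2 + a3 ^+ 2) + 3 * B.
Proof.
move=> b1B b2B b3B; set N := Num.sqrt (a1 ^+ 2 + _ + _).
have N0 : 0 <= N by exact: sqrtr_ge0.
have B0 : 0 <= B by exact: le_trans b1B.
have NE : N ^+ 2 = a1 ^+ 2 + a2 ^+ 2 + a3 ^+ 2.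
  by rewrite sqr_sqrtr// !addr_ge0// sqr_ge0.
have aN a : a ^+ 2 <= N ^+ 2 -> `|a| <= N.
  by rewrite -[a ^+ 2]real_normK ?num_real// ler_sqr ?nnegrE.
have step a b : a ^+ 2 <= N ^+ 2 -> `|b| <= B ->
    (a + b) ^+ 2 <= a ^+ 2 + 2 * (N * B) + B ^+ 2.
  move=> /aN Na bB; rewrite sqrrD lerD//.
    rewrite lerD2l -mulr_natl ler_wpM2l// (le_trans (ler_norm _))// normrM.
    by rewrite ler_pM.
  by rewrite -[b ^+ 2]real_normK ?num_real// ler_sqr ?nnegrE.
have s2 x : 0 <= x ^+ 2 :> R by exact: sqr_ge0.
rewrite -[leRHS]ger0_norm ?addr_ge0 ?mulr_ge0// -sqrtr_sqr ler_sqrt ?sqr_ge0//.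
have k1 : (a1 + b1) ^+ 2 <= a1 ^+ 2 + 2 * (N * B) + B ^+ 2.
  by apply: step => //; rewrite NE -addrA lerDl addr_ge0.
have k2 : (a2 + b2) ^+ 2 <= a2 ^+ 2 + 2 * (N * B) + B ^+ 2.
  by apply: step => //; rewrite NE addrAC lerDr addr_ge0.
have k3 : (a3 + b3) ^+ 2 <= a3 ^+ 2 + 2 * (N * B) + B ^+ 2.
  by apply: step => //; rewrite NE lerDr addr_ge0.
apply: le_trans (lerD (lerD k1 k2) k3) _.
have NB0 : 0 <= N * B by exact: mulr_ge0.
rewrite [leRHS]sqrrD NE; have := s2 B; nra.
Qed.

Lemma speed_add_le p v w (M e : R) : `|zc p| <= M ->
  (forall i : 'I_3, `|(w : 'rV[R]_3) 0 i| <= e) ->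
  Num.sqrt (ds2 p (v + w)) <= Num.sqrt (ds2 p v) + 3 * (expR M * e).
Proof.
move=> zM we; have M0 : 0 <= M by exact: le_trans zM.
have /andP[zM1 zM2] : - M <= zc p <= M by rewrite -ler_norml.
have bound a i : a <= M -> `|expR a * (w : 'rV[R]_3) 0 i| <= expR M * e.
  by move=> aM; rewrite normrM ger0_norm ?expR_ge0// ler_pM ?expR_ge0 ?ler_expR.
rewrite !ds2_sumsq /xc /yc /zc !mxE !mulrDr; apply: sqrt_sumsq_add_le.
- by apply: bound; rewrite lerNl.
- by apply: bound; rewrite -/(zc p); lra.
- by rewrite -[w 0 2]mul1r -expR0; exact: bound.
Qed.

End metric_estimates.

(* Indeed N - N' >= (1 - s ^ 2) h ^ 2 / (2 N), and h ^ 2 / N >= 2 l h - l ^ 2 N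
   for all l.  Being linear in h and N, this bound can be integrated along a curve
   without Cauchy-Schwarz. *)
Lemma scaled_norm_le (R : realType) (N N' A B s h l : R) :
  0 <= N -> 0 <= N' -> 0 <= B -> s ^+ 2 <= 1 -> h ^+ 2 <= A ->
  N ^+ 2 = A + B -> N' ^+ 2 = s ^+ 2 * A + B ->
  N' <= N - (1 - s ^+ 2) / 2 * (2 * l * h - l ^+ 2 * N).
Proof.
move=> N0 N'0 B0 s1 hA NE N'E.
have A0 : 0 <= A by exact: le_trans (sqr_ge0 h) hA.
have N'N : N' <= N.
  by rewrite -ler_sqr ?nnegrE// NE N'E lerD2r ler_piMl.
move: N0; rewrite le_eqVlt => /predU1P[N0|N0].
  have h0 : h = 0.
    apply/eqP; rewrite -sqrf_eq0 eq_le sqr_ge0 andbT (le_trans hA)//.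
    by move: NE; rewrite -N0 expr0n/=; lra.
  by rewrite h0 -N0 !mulr0 subrr mulr0 subr0 N0.
rewrite lerBrDr -lerBrDl -(ler_pM2l N0).
set k := (1 - s ^+ 2) / 2; have k0 : 0 <= k by rewrite /k; lra.
apply: (@le_trans _ _ (k * h ^+ 2)).
  have := mulr_ge0 k0 (sqr_ge0 (h - l * N)); lra.
(* This square yields [2 N (N - N') >= N^2 - N'^2 = (1 - s^2) A]. *)
have : 0 <= (N - N') ^+ 2 by exact: sqr_ge0.
have : k * h ^+ 2 <= k * A by exact: ler_wpM2l.
rewrite sqrrB N'E NE /k; lra.
Qed.

(** * Length estimates for a curve and its deformations *)

Section curve_estimates.
Context {R : realType} (c : R -> G_half R) (c_C1 : piecewise_C1 c).
Notation mu := (@lebesgue_measure R).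
Implicit Types (t : R) (i : 'I_3).

Let speed t := Num.sqrt (ds2 (c t) (derive1 c t)).

Let integrable_speed : mu.-integrable `[0, 1] (EFin \o speed).
Proof. exact: (piecewise_C1_integrable c_C1 (@continuous_speed R)). Qed.

Let integrable_velocity i :
  mu.-integrable `[0, 1] (EFin \o (fun t => (derive1 c t : 'rV[R]_3) 0 i)).
Proof.
apply: (piecewise_C1_integrable (F := fun u => (u.2 : 'rV[R]_3) 0 i) c_C1).
exact: continuous_coord_snd.
Qed.

Lemma curve_length_ge0 : 0 <= curve_length c.
Proof. by apply: Rintegral_ge0 => t _; exact: sqrtr_ge0. Qed.

Lemma normr_zc_sub_le_length t : t \in `[0, 1] ->
  `|zc (c t) - zc (c 0)| <= curve_length c.
Proof.
move=> t01; have /andP[t0 t1] : 0 <= t <= 1 by move: t01; rewrite in_itv.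
have sub : `[0, t] `<=` `[0, 1] by apply: subset_itvl; rewrite bnd_simp.
have intz : mu.-integrable `[0, t]
    (EFin \o (fun u => (derive1 c u : 'rV[R]_3) 0 2)).
  by apply: integrableS (integrable_velocity 2).
have ints : mu.-integrable `[0, t] (EFin \o speed).
  by apply: integrableS integrable_speed.
rewrite -piecewise_C1_FTC//.
apply: le_trans (le_normr_Rintegral _ intz) _ => //.
apply: (@le_trans _ _ (\int[mu]_(u in `[0, t]) speed u)).
  apply: le_Rintegral => //; first exact: integrable_abse intz.
  by move=> u _; exact: normr_zc_le_speed.
(* The length exceeds the integral over [[0, t]] by the integral of the nonnegative speed over the
   remaining times. *)
have := @Rintegral_itvB _ speed (BLeft 0) (BRight 1) t integrable_speed.
rewrite !bnd_simp => /(_ t0 t1) E.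
by rewrite -subr_ge0 E Rintegral_ge0// => u _; exact: sqrtr_ge0.
Qed.

Lemma normr_zc_le_length t : t \in `[0, 1] ->
  `|zc (c t)| <= `|zc (c 0)| + curve_length c.
Proof.
move=> /normr_zc_sub_le_length zL.
rewrite -[zc (c t)](subrK (zc (c 0))) addrC (le_trans (ler_normD _ _))//.
by rewrite lerD2l.
Qed.

(** The whole curve stays at heights bounded by [|zc (c 0)| + curve_length c], where each velocity
    coordinate is at most a fixed multiple of the speed. *)
Lemma normr_coord_sub_le_length i :
  `|(c 1 : 'rV[R]_3) 0 i - (c 0 : 'rV[R]_3) 0 i| <=
    expR (`|zc (c 0)| + curve_length c) * curve_length c.
Proof.
rewrite -piecewise_C1_FTC ?in_itv/= ?ler01 ?lexx//.
apply: le_trans (le_normr_Rintegral _ (integrable_velocity i)) _ => //.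
rewrite -RintegralZl//; apply: le_Rintegral => //.
- exact: integrable_abse (integrable_velocity i).
- by apply: (@integrableZl _ _ _ mu _ (measurable_itv _) _ _ integrable_speed).
- by move=> t t01; apply: normr_coord_le_speed; exact: normr_zc_le_length.
Qed.

Lemma piecewise_C1_ae_derive1 al be ga : exists s : seq R,
  forall t, t \in `]0, 1[ -> t \notin s ->
  derive1 (affine_curve al be ga c) t =
    \row_(i < 3) (al 0 i * (derive1 c t : 'rV[R]_3) 0 i + be 0 i).
Proof.
have [s ds] := piecewise_C1_derivable c_C1; exists s => t t01 ts.
by have [] := affine_curve_derive1 al be ga (ds t t01 ts).
Qed.

(** The bound of [scaled_norm_le] is a linear combination of the speed and one velocity coordinate.
    Its integral involves only the length and the end points of the curve. *)
Lemma Rintegral_speed_velocity i (a b : R) :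
  mu.-integrable `[0, 1]
    (EFin \o (fun t => a * speed t + b * (derive1 c t : 'rV[R]_3) 0 i)) /\
  \int[mu]_(t in `[0, 1]) (a * speed t + b * (derive1 c t : 'rV[R]_3) 0 i) =
    a * curve_length c + b * ((c 1 : 'rV[R]_3) 0 i - (c 0 : 'rV[R]_3) 0 i).
Proof.
have ia : mu.-integrable `[0, 1] (EFin \o (fun t => a * speed t)).
  exact: (@integrableZl _ _ _ mu _ (measurable_itv _) _ _ integrable_speed).
have ib : mu.-integrable `[0, 1]
    (EFin \o (fun t => b * (derive1 c t : 'rV[R]_3) 0 i)).
  exact: (@integrableZl _ _ _ mu _ (measurable_itv _) _ _
    (integrable_velocity i)).
split; first exact: (@integrableD _ _ _ mu _ (measurable_itv _) _ _ ia ib).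
rewrite RintegralD// !RintegralZl//.
by rewrite piecewise_C1_FTC// in_itv/= ler01 lexx.
Qed.

(** The scaling is centred on the vertical axis through [c 0], so that the starting point does not
    move. *)
Definition hscale_curve (s : R) : R -> G_half R :=
  affine_curve (\row_(i < 3) (if i == 2 then 1 else s)) 0
    (\row_(i < 3) (if i == 2 then 0 else (1 - s) * (c 0 : 'rV[R]_3) 0 i)) c.

(** Integrates [scaled_norm_le] with [A] and [B] the horizontal and vertical parts of the squared
    speed and [h] equal to [expR (- M)] times the velocity coordinate [i]. The gain in length
    depends on the curve only through its length and end points; [l] stays free to be optimised
    later. *)
Lemma curve_length_hscale_le (s l M : R) i : 0 <= s <= 1 -> i != 2 ->
  `|zc (c 0)| + curve_length c <= M ->
  curve_length (hscale_curve s) <= curve_length c - (1 - s ^+ 2) / 2 *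
    (2 * l * (expR (- M) * ((c 1 : 'rV[R]_3) 0 i - (c 0 : 'rV[R]_3) 0 i))
     - l ^+ 2 * curve_length c).
Proof.
move=> /andP[s0 s1] i2 LM; set k := (1 - s ^+ 2) / 2.
set al := \row_(i < 3) (if i == 2 then 1 else s).
set ga := \row_(i < 3) (if i == 2 then 0 else (1 - s) * (c 0 : 'rV[R]_3) 0 i).
have [r dr] := piecewise_C1_ae_derive1 al 0 ga.
have [intg intgE] := Rintegral_speed_velocity i (1 + k * l ^+ 2)
  (- (k * 2 * l * expR (- M))).
apply: (@le_trans _ _ (\int[mu]_(t in `[0, 1])
    ((1 + k * l ^+ 2) * speed t + - (k * 2 * l * expR (- M)) *
     (derive1 c t : 'rV[R]_3) 0 i))); last first.
  by rewrite intgE; lra.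
apply: (@le_Rintegral_off_finite _ r); [ | exact: intg | ].
  exact: (piecewise_C1_integrable (piecewise_C1_affine_curve _ _ _ c_C1)
    (@continuous_speed R)).
move=> t t01 tr; rewrite dr//.
have t01' : t \in `[0, 1] by exact: subset_itv_oo_cc t01.
(* The metric coefficients depend on the height alone, which the scaling preserves; hence the
   horizontal part of the squared speed is exactly multiplied by [s^2]. *)
have zE : zc (affine_curve al 0 ga c t) = zc (c t).
  by rewrite /zc !mxE/= mul1r mul0r !addr0.
set v := derive1 c t.
apply: le_trans (@scaled_norm_le _ (speed t) _ (ds2 (c t) v - zc v ^+ 2)
  (zc v ^+ 2) s (expR (- M) * (v : 'rV[R]_3) 0 i) l _ _ _ _ _ _ _) _.
- exact: sqrtr_ge0.
- exact: sqrtr_ge0.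
- exact: sqr_ge0.
- by rewrite -[leRHS](expr1n _ 2) ler_sqr ?nnegrE.
- apply: sqr_horizontal_le => //; apply: le_trans LM.
  exact: normr_zc_le_length.
- by rewrite sqr_sqrtr ?ds2_ge0// subrK.
- rewrite sqr_sqrtr ?ds2_ge0// /ds2 zE /xc /yc /zc !mxE/=.
  rewrite !addr0 mul1r; ring.
- rewrite -/k; lra.
Qed.

(** Adding [t] times [w] keeps the starting point and moves the end point by [w]. The change of base
    point costs the factor [expR e], the change of velocity the additive term. *)
Lemma curve_length_shear_le (w : 'rV[R]_3) (e M : R) :
  (forall i, `|w 0 i| <= e) -> `|zc (c 0)| + curve_length c <= M ->
  curve_length (affine_curve (const_mx 1) w 0 c) <=
    expR e * (curve_length c + 3 * (expR M * e)).
Proof.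
move=> we LM.
have e0 : 0 <= e by exact: le_trans (we 0).
have [r dr] := piecewise_C1_ae_derive1 (const_mx 1) w 0.
have intc : mu.-integrable `[0, 1] (EFin \o (fun _ : R => 3 * (expR M * e))).
  apply: continuous_compact_integrable; first exact: segment_compact.
  by move=> t; exact: cvg_cst.
have intD := @integrableD _ _ _ mu _ (measurable_itv _) _ _ integrable_speed intc.
have -> : expR e * (curve_length c + 3 * (expR M * e)) =
    \int[mu]_(t in `[0, 1]) (expR e * (speed t + 3 * (expR M * e))).
  rewrite RintegralZl//; congr (_ * _); rewrite RintegralD//; congr (_ + _).
  by rewrite Rintegral_cst01.
apply: (@le_Rintegral_off_finite _ r).
- exact: (piecewise_C1_integrable (piecewise_C1_affine_curve _ _ _ c_C1)
    (@continuous_speed R)).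
- exact: (@integrableZl _ _ _ mu _ (measurable_itv _) _ _ intD).
move=> t t01 tr; rewrite dr//.
have t01' : t \in `[0, 1] by exact: subset_itv_oo_cc t01.
apply: le_trans (@speed_base_le _ (c t) _ _ e _) _.
  rewrite /zc !mxE mul1r addr0 addrAC subrr add0r normrM -[leRHS]mulr1.
  rewrite ler_pM//; move: t01'; rewrite in_itv/= => /andP[t0 t1].
  by rewrite ger0_norm.
rewrite ler_wpM2l ?expR_ge0//.
have -> : \row_i ((const_mx 1 : 'rV[R]_3) 0 i * (derive1 c t : 'rV[R]_3) 0 i
    + w 0 i) = (derive1 c t : 'rV[R]_3) + w.
  by apply/rowP => i; rewrite !mxE mul1r.
apply: speed_add_le => //.
by apply: le_trans LM; exact: normr_zc_le_length.
Qed.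

End curve_estimates.

(** * Continuity from a growth bound *)

Lemma cvg_normB0 (R : realType) (V : normedModType R) (x : V) :
  `|y - x| @[y --> x] --> (0 : R).
Proof.
apply/cvgrPdist_lt => e e0; apply/nbhs_normP; exists e => // y /=.
by rewrite sub0r normrN normr_id distrC.
Qed.

Lemma normr_coord_le (R : realType) n (v : 'rV[R]_n) i : `|v 0 i| <= `|v|.
Proof.
by rewrite [leRHS]/Num.Def.normr/= mx_normrE; exact: (le_bigmax _ _ (0, i)).
Qed.

(** The bound from [q0] to [q] gives an upper estimate [U] of [f q], the bound from [q] back to [q0]
    a lower estimate [V]; both tend to [f q0]. *)
Lemma continuous_of_growth (R : realType) (W : normedModType R) (f : W -> R)
    (m : R) :
  (forall x y M, m + (f x + 1) <= M ->
    f y <= expR `|y - x| * (f x + 3 * (expR M * `|y - x|))) ->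
  continuous f.
Proof.
(* The summand 2 lets one [M] serve in both directions: the hypothesis takes 1, and
   [f q <= f q0 + 1] near [q0] takes the other. *)
move=> fle q0; set D := f q0; set M := m + (D + 2).
pose U e := expR e * (D + 3 * (expR M * e)).
pose V e := expR (- e) * D - 3 * (expR M * e).
have cM : continuous (fun e : R => 3 * (expR M * e)).
  move=> e; apply: cvgM; first exact: cvg_cst.
  by apply: cvgM; [exact: cvg_cst | exact: cvg_id].
have cU : continuous U.
  move=> e; apply: cvgM; first exact: continuous_expR.
  by apply: cvgD; [exact: cvg_cst | exact: cM].
have cV : continuous V.
  move=> e; apply: cvgB; last exact: cM.
  apply: cvgM; last exact: cvg_cst.
  apply: (@continuous_comp _ _ _ (fun x : R => - x) expR); last first.
    exact: continuous_expR.
  by apply: cvgN; exact: cvg_id.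
have e0 := cvg_normB0 q0.
have U0 : U `|q - q0| @[q --> q0] --> D.
  have := cvg_comp _ _ e0 (cU 0); rewrite /U expR0 !mulr0 addr0 mul1r; exact.
have V0 : V `|q - q0| @[q --> q0] --> D.
  have := cvg_comp _ _ e0 (cV 0).
  by rewrite /V oppr0 expR0 !mulr0 subr0 mul1r.
have nearU : \forall q \near q0, f q <= U `|q - q0|.
  apply: nearW => q; apply: fle.
  by rewrite lerD2l -/D -[2]/(1 + 1) addrA lerDl.
apply: (squeeze_cvgr _ V0 U0); near=> q; apply/andP; split; last by near: q.
have D1 : f q <= D + 1.
  apply: (@le_trans _ _ (U `|q - q0|)); first by near: q.
  rewrite ltW//; near: q.
  by apply: (cvgr_lt D U0); rewrite ltrDl.
rewrite /V lerBlDr expRN mulrC ler_pdivrMr ?expR_gt0// mulrC distrC.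
apply: fle.
by rewrite lerD2l; lra.
Unshelve. all: by end_near. Qed.

(** * The distance: vertical distances, strict decrease under scaling, continuity *)

Section distance.
Context {R : realType}.
Notation mu := (@lebesgue_measure R).
Implicit Types (p q : G_half R) (i : 'I_3).

Let coord (v : G_half R) i := (v : 'rV[R]_3) 0 i.

(** A straight segment of the chart. It shows that any two points are joined by an admissible curve,
    and it realises the distance when it is vertical. *)
Definition segment_curve p q : R -> G_half R :=
  affine_curve 0 ((q : 'rV[R]_3) - (p : 'rV[R]_3)) (p : 'rV[R]_3) (cst p).

Lemma segment_curve_C1 p q : [/\ piecewise_C1 (segment_curve p q),
  segment_curve p q 0 = p & segment_curve p q 1 = q].
Proof.
split; first exact/piecewise_C1_affine_curve/piecewise_C1_cst.
  by apply/rowP => i; rewrite !mxE mul0r mulr0 !add0r.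
by apply/rowP => i; rewrite !mxE mul0r mulr1 add0r subrK.
Qed.

Let lengths p q := [set curve_length c | c in
    [set c : R -> G_half R | [/\ piecewise_C1 c, c 0 = p & c 1 = q]]].

(** Excludes the default value of [inf], which is returned on sets that are empty or not bounded
    below. *)
Let has_inf_lengths p q : has_inf (lengths p q).
Proof.
split; last by exists 0 => _ [c _ <-]; exact: curve_length_ge0.
by eexists; exists (segment_curve p q); [exact: segment_curve_C1 | reflexivity].
Qed.

Lemma G_half_dist_le_length (c : R -> G_half R) : piecewise_C1 c ->
  G_half_dist (c 0) (c 1) <= curve_length c.
Proof.
move=> cC1; apply: ge_inf; first by have [] := has_inf_lengths (c 0) (c 1).
by exists c.
Qed.

Lemma G_half_dist_adherent p q (e : R) : 0 < e ->
  exists c : R -> G_half R, [/\ piecewise_C1 c, c 0 = p, c 1 = q &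
    curve_length c < G_half_dist p q + e].
Proof.
by move=> /inf_adherent /(_ (has_inf_lengths p q)) [_ [c [? ? ?] <-]]; exists c.
Qed.

Lemma normr_zc_sub_le_dist p q : `|zc q - zc p| <= G_half_dist p q.
Proof.
apply/ler_addgt0Pr => e /(G_half_dist_adherent p q) [c [cC1 <- <- /ltW]].
apply: le_trans; apply: normr_zc_sub_le_length => //.
by rewrite in_itv/= ler01 lexx.
Qed.

Lemma G_half_dist_ge0 p q : 0 <= G_half_dist p q.
Proof. exact: le_trans (normr_zc_sub_le_dist p q). Qed.

Lemma G_half_dist_vertical p q : xc q = xc p -> yc q = yc p ->
  G_half_dist p q = `|zc q - zc p|.
Proof.
move=> xE yE; apply/eqP; rewrite eq_le normr_zc_sub_le_dist andbT.
have [C1 E0 E1] := segment_curve_C1 p q.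
have := G_half_dist_le_length C1; rewrite E0 E1 => /le_trans; apply.
rewrite le_eqVlt; apply/orP; left; apply/eqP.
transitivity (\int[mu]_(t in `[0, 1]) `|zc q - zc p|).
  apply: eq_Rintegral => t _; rewrite -sqrtr_sqr; congr Num.sqrt.
  have [_ ->] := affine_curve_derive1 0 ((q : 'rV[R]_3) - (p : 'rV[R]_3))
    (p : 'rV[R]_3) (derivable_cst p t 1).
  rewrite /ds2 /xc /yc /zc !mxE !mul0r !add0r.
  rewrite -/(xc p) -/(xc q) -/(yc p) -/(yc q) xE yE !subrr.
  by rewrite expr0n/= !mulr0 !add0r.
exact: Rintegral_cst01.
Qed.

(** Taken along a curve of length less than the distance plus 1. Balls are thus bounded in the
    chart, which serves both for compactness and to make horizontal rays leave every ball. *)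
Lemma normr_coord_sub_le_dist p q i : `|coord q i - coord p i| <=
  expR (`|zc p| + (G_half_dist p q + 1)) * (G_half_dist p q + 1).
Proof.
have [c [cC1 c0 c1 /ltW cd]] := G_half_dist_adherent p q ltr01.
have := normr_coord_sub_le_length cC1 i; rewrite c0 c1 => /le_trans; apply.
rewrite ler_pM ?expR_ge0 ?curve_length_ge0// ler_expR.
by rewrite lerD2l.
Qed.

Definition hscale p (s : R) q : G_half R :=
  \row_(i < 3) (if i == 2 then coord q i
                else coord p i + s * (coord q i - coord p i)).

(** Strictness survives the infimum because the gain in length is at least [k * (l * h) > 0],
    uniformly over all curves of length at most [D + 1]; a curve whose excess over [D] is smaller
    than this gain suffices. *)
Lemma G_half_dist_hscale_lt p q (s : R) i : 0 <= s < 1 -> i != 2 ->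
  coord q i != coord p i -> G_half_dist p (hscale p s q) < G_half_dist p q.
Proof.
move=> /andP[s0 s1] i2 qpi; set D := G_half_dist p q.
have D0 : 0 <= D by exact: G_half_dist_ge0.
set M := `|zc p| + (D + 1); set h := expR (- M) * (coord q i - coord p i).
have h0 : 0 < h ^+ 2.
  by rewrite exprn_even_gt0//= mulf_neq0 ?subr_eq0// gt_eqF ?expR_gt0.
set k := (1 - s ^+ 2) / 2.
have k0 : 0 < k by rewrite divr_gt0// subr_gt0 expr_lt1.
(* The value of [l] maximising [2 l h - l^2 (D + 1)]; the maximum is [l h]. *)
set l := h / (D + 1).
have D10 : 0 < D + 1 by rewrite ltr_wpDl.
have dl0 : 0 < k * (l * h).
  have -> : l * h = h ^+ 2 / (D + 1) by rewrite /l expr2 mulrAC.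
  by apply: mulr_gt0 => //; exact: divr_gt0.
have e0 : 0 < Num.min 1 (k * (l * h)) by rewrite lt_min ltr01.
have [c [cC1 c0 c1]] := G_half_dist_adherent p q e0.
rewrite -/D -ltrBlDl lt_min => /andP[L1 L2].
have s01 : 0 <= s <= 1 by rewrite s0 ltW.
have LM : `|zc (c 0)| + curve_length c <= M.
  by rewrite c0 lerD2l -lerBlDl ltW.
have E1 : hscale_curve c s 1 = hscale p s q.
  apply/rowP => j; rewrite !mxE c0 c1 mul0r addr0 /coord.
  by case: ifP => _; ring.
have E0 : hscale_curve c s 0 = p.
  apply/rowP => j; rewrite !mxE c0 mulr0 addr0.
  by case: ifP => _; ring.
have C1s : piecewise_C1 (hscale_curve c s) by exact: piecewise_C1_affine_curve.
have := G_half_dist_le_length C1s; rewrite E0 E1 => /le_lt_trans; apply.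
apply: le_lt_trans (curve_length_hscale_le cC1 l s01 i2 LM) _.
rewrite c0 c1 -/(coord q i) -/(coord p i) -/h -/k.
have : k * (l ^+ 2 * curve_length c) <= k * (l * h).
  apply: ler_wpM2l; first exact: ltW.
  have -> : l * h = l ^+ 2 * (D + 1) by rewrite /l; field; rewrite gt_eqF.
  by apply: ler_wpM2l; [exact: sqr_ge0 | rewrite -lerBlDl ltW].
by lra.
Qed.

(** Shear an almost shortest curve from [p] to [q] so that it ends at [q']. *)
Lemma G_half_dist_shear_le p (q q' : 'rV[R]_3) (M : R) :
  `|zc p| + (G_half_dist p q + 1) <= M ->
  G_half_dist p q' <= expR `|q' - q| *
    (G_half_dist p q + 3 * (expR M * `|q' - q|)).
Proof.
move=> DM; set e := `|q' - q|.
apply/ler_addgt0Pr => eps eps0.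
(* The shear multiplies the excess length by [expR e], hence the division by it here; the 1 keeps
   the curve within the height bound [M]. *)
have e1 : 0 < Num.min 1 (eps / expR e).
  by rewrite lt_min ltr01 divr_gt0// expR_gt0.
have [c [cC1 c0 c1]] := G_half_dist_adherent p q e1.
rewrite -ltrBlDl lt_min => /andP[L1 L2].
have LM : `|zc (c 0)| + curve_length c <= M.
  by rewrite c0; apply: le_trans DM; rewrite lerD2l -lerBlDl ltW.
pose w := q' - q.
have we i : `|w 0 i| <= e by exact: normr_coord_le.
have E0 : affine_curve (const_mx 1) w 0 c 0 = p.
  by apply/rowP => j; rewrite !mxE mul1r mulr0 !addr0 c0.
have E1 : affine_curve (const_mx 1) w 0 c 1 = q'.
  by apply/rowP => j; rewrite /w !mxE mul1r mulr1 addr0 c1 addrCA subrr addr0.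
have := G_half_dist_le_length (piecewise_C1_affine_curve (const_mx 1) w 0 cC1).
rewrite E0 E1 => /le_trans; apply.
apply: le_trans (curve_length_shear_le cC1 we LM) _.
have : expR e * (curve_length c - G_half_dist p q) <= eps.
  by rewrite mulrC -ler_pdivlMr ?expR_gt0// ltW.
by lra.
Qed.

Lemma continuous_G_half_dist p : continuous (G_half_dist p : 'rV[R]_3 -> R).
Proof.
apply: (@continuous_of_growth _ _ _ `|zc p|) => x y M.
exact: G_half_dist_shear_le.
Qed.

End distance.

(** * Topological criteria *)

(** The map is closed: a closed part of [A] is compact, so its image is compact, hence closed in the
    Hausdorff space [Y]. *)
Lemma compact_bij_homeomorphic (X Y : topologicalType) (A : set X) (B : set Y)
    (f : X -> Y) :
  compact A -> hausdorff_space Y -> {within A, continuous f} -> set_bij A B f ->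
  homeomorphic (set_type A) (set_type B).
Proof.
move=> cA hY cf [fun_f inj_f surj_f].
have fB (x : A) : f (set_val x) \in B by exact/mem_set/fun_f/set_mem/valP.
have gA (y : B) : {x : A | f (set_val x) = set_val y}.
  apply: cid; have [x Ax fx] := surj_f _ (set_mem (valP y)).
  by exists (exist _ x (mem_set Ax)).
pose F (x : A) : B := exist _ (f (set_val x)) (fB x).
pose G (y : B) : A := sval (gA y).
have FG : cancel G F by move=> y; apply: val_inj; exact: (svalP (gA y)).
have GF : cancel F G.
  move=> x; apply: val_inj; apply: inj_f; [exact: valP | exact: valP |].
  exact: (svalP (gA (F x))).
exists F, G; split => //.
  apply: continuous_comp_initial.
  exact/(subspace_sigL_continuousP A f).
apply/continuousP => _ [V oV <-].
have cK : closed (f @` (A `&` ~` V)).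
  apply: (compact_closed hY); apply: continuous_compact.
    by apply: continuous_subspaceW cf; exact: subIsetl.
  by apply: compact_closedI => //; exact: open_closedC.
(* The preimage of [V] under the inverse map is the trace on [B] of the complement of
   [f (A \ V)]. *)
exists (~` (f @` (A `&` ~` V))); first exact: closed_openC.
apply/seteqP; split=> y /=.
  move=> yK; apply: contrapT => GyV; apply: yK; exists (set_val (G y)).
    by split=> //; exact/set_mem/valP.
  exact: (svalP (gA y)).
move=> GyV [x [Ax xV] fx]; apply: xV.
suff -> : x = set_val (G y) by [].
apply: inj_f; [exact: mem_set | exact: valP |].
by rewrite fx -(svalP (gA y)).
Qed.

Lemma continuous_dominated0 (R : realType) (T : topologicalType)
    (f g : T -> R) (x : T) :
  {for x, continuous g} -> g x = 0 -> f x = 0 -> (forall y, `|f y| <= g y) ->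
  {for x, continuous f}.
Proof.
move=> cg gx fx fg.
have g0 : g y @[y --> x] --> (0 : R) by rewrite -gx.
have Ng0 : - g y @[y --> x] --> (0 : R) by rewrite -oppr0; exact: cvgN.
suff : f y @[y --> x] --> (0 : R) by rewrite -fx.
apply: (squeeze_cvgr _ Ng0 g0); apply: nearW => y.
by rewrite -ler_norml.
Qed.

(** * The map from the geodesic sphere onto the round sphere *)

Section sphere.
Context {R : realType} (p : G_half R) (r : R) (r_gt0 : 0 < r).
Implicit Types (q : 'rV[R]_3).

Let o : 'rV[R]_3 := p.
Let d : 'rV[R]_3 -> R := G_half_dist p.
Let height q := (q 0 2 - o 0 2) / r.
Let radius q := Num.sqrt ((q 0 0 - o 0 0) ^+ 2 + (q 0 1 - o 0 1) ^+ 2).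
(** The factor bringing the horizontal part of [q - o] to the length it has on the unit sphere at
    height [height q]. On the axis it is 0, by the convention for division by zero. *)
Let scale q := Num.sqrt (1 - height q ^+ 2) / radius q.
Let Phi q : 'rV[R]_3 :=
  \row_(i < 3) (if i == 2 then height q else scale q * (q 0 i - o 0 i)).

Let Phi2 q : Phi q 0 2 = height q. Proof. by rewrite mxE. Qed.

Let PhiN2 q (i : 'I_3) : i != 2 -> Phi q 0 i = scale q * (q 0 i - o 0 i).
Proof. by move=> i2; rewrite mxE (negPf i2). Qed.

Let ord3P (P : 'I_3 -> Prop) : P 0 -> P 1 -> P 2 -> forall i, P i.
Proof.
move=> P0 P1 P2 [[|[|[|//]]] i3].
- by rewrite (_ : Ordinal i3 = 0)//; exact/val_inj.
- by rewrite (_ : Ordinal i3 = 1)//; exact/val_inj.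
- by rewrite (_ : Ordinal i3 = 2)//; exact/val_inj.
Qed.

Let sumsq_ge0 (x y : R) : 0 <= x ^+ 2 + y ^+ 2.
Proof. by rewrite addr_ge0 ?sqr_ge0. Qed.

Let radius_ge0 q : 0 <= radius q. Proof. exact: sqrtr_ge0. Qed.

Let sqr_radius q :
  radius q ^+ 2 = (q 0 0 - o 0 0) ^+ 2 + (q 0 1 - o 0 1) ^+ 2.
Proof. by rewrite sqr_sqrtr. Qed.

Let normr_coord_le_radius q (i : 'I_3) : i != 2 -> `|q 0 i - o 0 i| <= radius q.
Proof.
elim/ord3P: i => // _; rewrite -sqrtr_sqr ler_sqrt//.
  by rewrite lerDl sqr_ge0.
by rewrite lerDr sqr_ge0.
Qed.

Let radius_eq0 q : radius q = 0 -> forall i : 'I_3, i != 2 -> q 0 i = o 0 i.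
Proof.
move=> q0 i /(normr_coord_le_radius q); rewrite q0 normr_le0 subr_eq0.
by move/eqP.
Qed.

Let height_le1 q : d q = r -> height q ^+ 2 <= 1.
Proof.
move=> dq; have := normr_zc_sub_le_dist p q; rewrite -[G_half_dist p q]/(d q) dq.
move=> zr; rewrite /height expr_div_n ler_pdivrMr ?exprn_gt0// mul1r.
by rewrite -[leLHS]real_normK ?num_real// ler_sqr ?nnegrE// ltW.
Qed.

Let axis_height q : d q = r -> radius q = 0 -> height q ^+ 2 = 1.
Proof.
move=> dq q0; have := @G_half_dist_vertical R p q (radius_eq0 (i := 0) q0 isT)
  (radius_eq0 (i := 1) q0 isT).
rewrite -[G_half_dist p q]/(d q) dq => zE.
rewrite /height expr_div_n -real_normK ?num_real// -[X in `|X|]/(zc q - zc p).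
by rewrite -zE divff// expf_neq0// gt_eqF.
Qed.

Let hscale0_dist q : d (hscale p 0 q) = `|q 0 2 - o 0 2|.
Proof.
by rewrite /d G_half_dist_vertical; rewrite /xc /yc /zc !mxE//= mul0r addr0.
Qed.

Let radius_neq0 q :
  radius q != 0 -> exists2 i : 'I_3, i != 2 & q 0 i != o 0 i.
Proof.
move=> q0; have [E0|] := eqVneq (q 0 0) (o 0 0); last by exists 0.
have [E1|] := eqVneq (q 0 1) (o 0 1); last by exists 1.
by move: q0; rewrite /radius E0 E1 !subrr expr0n/= addr0 sqrtr0 eqxx.
Qed.

(** Scaling by 0 projects [q] onto the axis at the same height and strictly decreases the distance,
    which becomes [|z - z0|]. *)
Let off_axis_height q : d q = r -> radius q != 0 -> height q ^+ 2 < 1.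
Proof.
move=> dq q0.
have [i i2 qi] := radius_neq0 q0.
have s01 : 0 <= (0 : R) < 1 by rewrite lexx ltr01.
have := G_half_dist_hscale_lt s01 i2 qi.
rewrite -[G_half_dist p q]/(d q) -[X in X < _]/(d (hscale p 0 q)) hscale0_dist dq.
rewrite /height expr_div_n ltr_pdivrMr ?exprn_gt0// mul1r => zr.
by rewrite -[ltLHS]real_normK ?num_real// ltr_sqr ?nnegrE// ltW.
Qed.

Let sum3 (F : 'I_3 -> R) : \sum_(i < 3) F i = F 0 + F 1 + F 2.
Proof.
rewrite !big_ord_recl big_ord0 addr0 addrA.
by congr (_ + F _ + F _); exact/val_inj.
Qed.

Let sqr_colatitude q : d q = r ->
  Num.sqrt (1 - height q ^+ 2) ^+ 2 = 1 - height q ^+ 2.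
Proof. by move=> dq; rewrite sqr_sqrtr// subr_ge0 height_le1. Qed.

Let Phi_unit q : d q = r -> unit_sphere R 2 (Phi q).
Proof.
move=> dq; rewrite /unit_sphere/= sum3 Phi2 !PhiN2//.
rewrite ![(scale q * _) ^+ 2]exprMn -mulrDr -sqr_radius.
have [q0|q0] := eqVneq (radius q) 0.
  by rewrite q0 expr0n mulr0 add0r axis_height.
by rewrite [scale q ^+ 2]expr_div_n divfK ?expf_neq0// sqr_colatitude// subrK.
Qed.

Let scale_gt0 q : d q = r -> radius q != 0 -> 0 < scale q.
Proof.
move=> dq q0; rewrite divr_gt0//; last by rewrite lt_def q0 radius_ge0.
by rewrite sqrtr_gt0 subr_gt0 off_axis_height.
Qed.

Let height_inj q q' : Phi q = Phi q' -> q 0 2 = q' 0 2 /\ height q = height q'.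
Proof.
move=> /rowP /(_ 2); rewrite !Phi2 => E; split=> //.
by move: E => /mulIf; rewrite invr_eq0 gt_eqF// => /(_ isT) /addIr.
Qed.

(** Otherwise [q] is the image of [q'] under the scaling of ratio [scale q' / scale q < 1], hence
    strictly nearer to [p], although both lie on the sphere. *)
Let scale_le q q' : d q = r -> d q' = r -> radius q != 0 -> radius q' != 0 ->
  Phi q = Phi q' -> scale q <= scale q'.
Proof.
move=> dq dq' q0 q'0 PhiE; rewrite leNgt; apply/negP => lt_scale.
have sq := scale_gt0 dq q0; have sq' := scale_gt0 dq' q'0.
have [i i2 qi] := radius_neq0 q'0.
have s01 : 0 <= scale q' / scale q < 1.
  by rewrite divr_ge0 ?ltW//= ltr_pdivrMr// mul1r.
have := G_half_dist_hscale_lt s01 i2 qi.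
suff -> : hscale p (scale q' / scale q) q' = q.
  by rewrite -[G_half_dist p q]/(d q) -[G_half_dist p q']/(d q') dq dq' ltxx.
apply/rowP => j; rewrite mxE; case: ifPn => [/eqP ->|j2].
  by have [->] := height_inj PhiE.
have /rowP /(_ j) := PhiE; rewrite !PhiN2// => E.
by rewrite -/(o 0 j) mulrAC -E mulrAC divff ?gt_eqF// mul1r addrC subrK.
Qed.

(** On the sphere the height tells whether a point lies on the axis, so [q] and [q'] are both poles
    or both off the axis. In the latter case [scale_le] applies in both directions. *)
Let inj_Phi q q' : d q = r -> d q' = r -> Phi q = Phi q' -> q = q'.
Proof.
move=> dq dq' PhiE; have [q2 hE] := height_inj PhiE.
have rE : (radius q == 0) = (radius q' == 0).
  have [q0|q0] := eqVneq (radius q) 0;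
    have [q'0|q'0] := eqVneq (radius q') 0 => //.
    by have := off_axis_height dq' q'0; rewrite -hE axis_height// ltxx.
  by have := off_axis_height dq q0; rewrite hE axis_height// ltxx.
apply/rowP => j; have [->//|j2] := eqVneq j 2.
have [q0|q0] := eqVneq (radius q) 0.
  have q'0 : radius q' = 0 by apply/eqP; rewrite -rE q0.
  by rewrite (radius_eq0 q0 j2) (radius_eq0 q'0 j2).
have q'0 : radius q' != 0 by rewrite -rE.
have sE : scale q = scale q'.
  by apply/eqP; rewrite eq_le !scale_le.
have /rowP /(_ j) := PhiE; rewrite !PhiN2// sE.
by move=> /mulfI; rewrite gt_eqF ?scale_gt0// => /(_ isT) /addIr.
Qed.

Let bound (s : R) := expR (`|zc p| + (s + 1)) * (s + 1).

Let bound_ge0 : 0 <= bound r.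
Proof. by rewrite mulr_ge0 ?expR_ge0 ?addr_ge0// ltW. Qed.

Let normr_coord_sub_le_bound q i : d q <= r -> `|q 0 i - o 0 i| <= bound r.
Proof.
move=> dr; apply: le_trans (@normr_coord_sub_le_dist R p q i) _.
rewrite -[G_half_dist p q]/(d q) ler_pM ?expR_ge0//.
- by rewrite addr_ge0// G_half_dist_ge0.
- by rewrite ler_expR !lerD.
- by rewrite lerD2r.
Qed.

(** Intermediate value theorem for the distance along the horizontal ray [Q], issued from the axis
    at height [r] times that of [b] and directed by the horizontal part of [b]. *)
Let surj_Phi (b : 'rV[R]_3) : unit_sphere R 2 b ->
  exists2 q, d q = r & Phi q = b.
Proof.
rewrite /unit_sphere/= sum3 => b1.
pose Q t : 'rV[R]_3 :=
  \row_(i < 3) (if i == 2 then o 0 2 + r * b 0 2 else o 0 i + t * b 0 i).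
have hQ t : height (Q t) = b 0 2.
  by rewrite /height mxE/= addrC addKr mulrC mulKf// gt_eqF.
have dQ0 : d (Q 0) = r * `|b 0 2|.
  rewrite -[in RHS](gtr0_norm r_gt0) -normrM.
  rewrite /d G_half_dist_vertical; rewrite /xc /yc /zc !mxE//= ?mul0r ?addr0//.
  by rewrite addrC addKr.
pose s := b 0 0 ^+ 2 + b 0 1 ^+ 2.
have rQ t : 0 <= t -> radius (Q t) = t * Num.sqrt s.
  move=> t0; rewrite /radius !mxE/= ![_ + t * _]addrC !addrK !exprMn -mulrDr.
  by rewrite sqrtrM ?sqr_ge0// sqrtr_sqr ger0_norm.
have QN2 t i : i != 2 -> Q t 0 i - o 0 i = t * b 0 i.
  by move=> i2; rewrite mxE (negPf i2) addrC addKr.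
(* Here [b] is a pole and the ray is reduced to a point of the axis. *)
have [s0|s0] := eqVneq s 0.
  have b0 i : i != 2 -> b 0 i = 0.
    move: s0 => /eqP; rewrite paddr_eq0 ?sqr_ge0// !sqrf_eq0.
    move=> /andP[/eqP ? /eqP ?].
    by elim/ord3P: i.
  exists (Q 0).
    rewrite dQ0; move: b1; rewrite -/s s0 add0r => /eqP.
    by rewrite sqrf_eq1 => /orP[] /eqP ->; rewrite ?normrN normr1 mulr1.
  apply/rowP => i; have [->|i2] := eqVneq i 2; first by rewrite Phi2 hQ.
  by rewrite PhiN2// QN2// mul0r mulr0 b0.
have s_gt0 : 0 < s by rewrite lt_def s0 sumsq_ge0.
have sE : 1 - b 0 2 ^+ 2 = s by rewrite -b1 addrK.
have dQ0_lt : d (Q 0) < r.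
  rewrite dQ0 gtr_pMr// -ltr_sqr ?nnegrE// expr1n real_normK ?num_real//.
  by rewrite -subr_gt0 sE.
have [i i2 bi] : exists2 i : 'I_3, i != 2 & b 0 i != 0.
  have [E0|] := eqVneq (b 0 0) 0; last by exists 0.
  have [E1|] := eqVneq (b 0 1) 0; last by exists 1.
  by move: s0; rewrite /s E0 E1 expr0n/= addr0 eqxx.
(* At time [T] the coordinate [i] differs from that of [o] by [bound r + 1] in absolute value, too
   much for a point of the closed ball of radius [r]. *)
pose T := (bound r + 1) / `|b 0 i|.
have T0 : 0 <= T by rewrite divr_ge0// addr_ge0.
have dQT_gt : r < d (Q T).
  rewrite ltNge; apply/negP => /(@normr_coord_sub_le_bound _ i).
  rewrite QN2// normrM ger0_norm// divfK ?normr_eq0//.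
  by rewrite leNgt ltrDl ltr01.
have cQ : continuous Q.
  move=> t; apply: (@cvg_rV R 3) => j; rewrite mxE; under eq_fun do rewrite mxE.
  case: ifP => _; first exact: cvg_cst.
  apply: cvgD; first exact: cvg_cst.
  by apply: cvgM; [exact: cvg_id | exact: cvg_cst].
have cdQ : continuous (d \o Q).
  move=> t; apply: continuous_comp; first exact: cQ.
  exact: continuous_G_half_dist.
have [||t] := @IVT R (d \o Q) 0 T r T0.
- exact: continuous_subspaceT.
- by rewrite ge_min le_max /= (ltW dQ0_lt) (ltW dQT_gt) orbT.
rewrite in_itv/= => /andP[t0 _] dQt; exists (Q t) => //.
have t_neq0 : t != 0.
  by apply/eqP => tE; move: dQ0_lt; rewrite -tE dQt ltxx.
apply/rowP => j; have [->|j2] := eqVneq j 2; first by rewrite Phi2 hQ.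
rewrite PhiN2// QN2// /scale hQ sE rQ//.
by rewrite mulrA; field; rewrite t_neq0 gt_eqF// sqrtr_gt0.
Qed.

Let bij_Phi : set_bij [set q | d q = r] (unit_sphere R 2) Phi.
Proof.
split.
- exact: Phi_unit.
- by move=> q q' /set_mem dq /set_mem dq'; exact: inj_Phi.
- by move=> b /surj_Phi [q dq <-]; exists q.
Qed.

Let continuous_coord (i : 'I_3) : continuous (fun q => q 0 i - o 0 i).
Proof.
move=> q; apply: continuousB; last exact: cst_continuous.
exact: coord_continuous.
Qed.

Let continuous_height : continuous height.
Proof.
move=> q; apply: (@continuousM _ _ (fun q => q 0 2 - o 0 2) (cst r^-1)).
  exact: continuous_coord.
exact: cst_continuous.
Qed.

Let continuous_radius : continuous radius.
Proof.
move=> q; apply: (@continuous_comp _ _ _ (fun q => (q 0 0 - o 0 0) ^+ 2 +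
  (q 0 1 - o 0 1) ^+ 2) Num.sqrt); last exact: sqrt_continuous.
by apply: continuousD; apply: continuousM; exact: continuous_coord.
Qed.

Let continuous_colatitude : continuous (fun q => Num.sqrt (1 - height q ^+ 2)).
Proof.
move=> q; apply: (@continuous_comp _ _ _ (fun q => 1 - height q ^+ 2) Num.sqrt).
  apply: continuousB; first exact: cst_continuous.
  by apply: continuousM; exact: continuous_height.
exact: sqrt_continuous.
Qed.

Let continuous_Phi q : d q = r -> {for q, continuous Phi}.
Proof.
move=> dq; apply: (@cvg_rV R 3 'rV[R]_3 (nbhs q) (nbhs_filter q)) => i.
rewrite mxE; under eq_fun do rewrite mxE.
case: ifPn => [_|i2]; first exact: continuous_height.
have [q0|q0] := eqVneq (radius q) 0; last first.
  apply: continuousM; last exact: continuous_coord.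
  apply: continuousM; first exact: continuous_colatitude.
  by apply: continuousV => //; exact: continuous_radius.
(* At a pole the quotient in [scale] degenerates. Since [|x 0 i - o 0 i| <= radius x], each
   horizontal coordinate of [Phi x] is bounded, for every [x], by [Num.sqrt (1 - height x ^+ 2)],
   which is continuous and vanishes at [q]. *)
apply: (continuous_dominated0 (@continuous_colatitude q)).
- by rewrite axis_height// subrr sqrtr0.
- by rewrite (radius_eq0 q0 i2) subrr mulr0.
move=> x; rewrite /scale.
have [x0|x0] := eqVneq (radius x) 0.
  by rewrite x0 invr0 mulr0 mul0r normr0 sqrtr_ge0.
rewrite -mulrA normrM ger0_norm ?sqrtr_ge0// ler_piMr ?sqrtr_ge0//.
have x1 : 0 < radius x by rewrite lt_def x0 radius_ge0.
rewrite normrM gtr0_norm ?invr_gt0// mulrC ler_pdivrMr// mul1r.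
exact: normr_coord_le_radius.
Qed.

Let compact_sphere : compact [set q | d q = r].
Proof.
apply: (@bounded_closed_compact R 3).
  exists (`|o| + bound r); split; first exact: num_real.
  move=> x /ltW Kx q /= dq; apply: le_trans Kx.
  have K0 : 0 <= `|o| + bound r by rewrite addr_ge0.
  rewrite [leLHS]/Num.Def.normr/= mx_normrE (bigmax_le _ K0)//= => -[j i] _.
  rewrite ord1 /= -[q 0 i](subrK (o 0 i)) addrC (le_trans (ler_normD _ _))//.
  rewrite lerD ?normr_coord_le//.
  by apply: normr_coord_sub_le_bound; rewrite dq.
rewrite (_ : [set q | d q = r] = d @^-1` [set r])//.
apply: preimage_closed; last exact: closed_eq.
by move=> q _; exact: continuous_G_half_dist.
Qed.

Lemma geodesic_sphere_homeomorphic :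
  homeomorphic (set_type (geodesic_sphere p r)) (set_type (unit_sphere R 2)).
Proof.
apply: (@compact_bij_homeomorphic _ _ (geodesic_sphere p r) _ Phi).
- exact: compact_sphere.
- exact: norm_hausdorff.
- apply/subspace_continuousP => q dq; apply: cvg_within_filter.
  exact: continuous_Phi.
- exact: bij_Phi.
Qed.

End sphere.

Theorem corollary3p26 (R : realType) (p : G_half R) (r : R) (hr : 0 < r) :
  homeomorphic (set_type (geodesic_sphere p r)) (set_type (unit_sphere R 2)).
Proof. exact: geodesic_sphere_homeomorphic. Qed.
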